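(* Let $m\ge 1$ and $n\ge 0$ be integers and let $\mathcal{P}_k$ be the space of $k$-homogeneous polynomials on the superspace $\mathbb{R}^{m|2n}$. For each $k\in\mathbb{N}_0$ we have the direct sum decomposition $$\mathcal{P}_k=\tilde{\mathcal{H}}_k\oplus R^2\Delta R^2\,\mathcal{P}_{k-2},$$ where $\tilde{\mathcal{H}}_k=\{P\in\mathcal{P}_k \mid \Delta R^2\Delta P=0\}$.
   Context: $\mathbb{N}_0=\{0,1,2,\dots\}$. Polynomials on $\mathbb{R}^{m|2n}$: $\mathcal{P}=\mathbb{R}[x_1,\dots,x_m]\otimes\Lambda_{2n}$, where $x_1,\dots,x_m$ are commuting variables and $\Lambda_{2n}$ is the real Grassmann algebra generated by anticommuting variables $\theta_1,\dots,\theta_{2n}$. The $\partial_{x_i}$ are the usual partial derivatives, acting trivially on the $\theta_j$; the $\partial_{\theta_j}$ are the odd (left) derivatives, i.e. $\partial_{\theta_i}\theta_j+\theta_j\partial_{\theta_i}=\delta_{ij}$, $\partial_{\theta_i}1=0$, $\partial_{\theta_i}$ commutes with the $x_j$ and $\partial_{x_j}$, and the $\partial_{\theta_i}$ anticommute with each other. Operators on $\mathcal{P}$: the super Laplace operator $$\Delta=\sum_{j=1}^m\partial_{x_j}^2-4\sum_{j=1}^n\partial_{\theta_{2j-1}}\partial_{\theta_{2j}},$$ the super Euler operator $\mathbb{E}=\sum_{j=1}^m x_j\partial_{x_j}+\sum_{j=1}^{2n}\theta_j\partial_{\theta_j}$, and (multiplication by) the square of the super norm $$R^2=\sum_{j=1}^m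 x_j^2-\sum_{j=1}^n\theta_{2j-1}\theta_{2j}.$$ $\mathcal{P}_k=\{P\in\mathcal{P}\mid \mathbb{E}P=kP\}$, so $\mathcal{P}_k=0$ for $k<0$. Products such as $R^2\Delta R^2$ denote compositions of operators. *)

(* Defs.v *)
From HB Require Import structures.
From mathcomp Require Import all_boot all_order all_algebra.

Set Implicit Arguments.
Unset Strict Implicit.
Unset Printing Implicit Defensive.

Import GRing.Theory.
Local Open Scope ring_scope.

(* Grassmann algebra over a commutative ring K on N generators, in coordinates:
   F A is the coefficient of theta_{a_1} ... theta_{a_r}, where
   A = {a_1 < ... < a_r}. *)
Definition grassmann (K : comNzRingType) (N : nat) : Type :=
  {ffun {set 'I_N} -> K}.

HB.instance Definition _ K N := GRing.Zmodule.copy (grassmann K N)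
  {ffun {set 'I_N} -> K}.

Section Grassmann.
Variables (K : comNzRingType) (N : nat).
Implicit Types (A B C D : {set 'I_N}) (F G H : grassmann K N) (i j : 'I_N).

Definition inversions A B : {set 'I_N * 'I_N} :=
  [set p | [&& p.1 \in A, p.2 \in B & (p.2 < p.1)%N]].

(* For disjoint A and B, theta_A theta_B = gsign A B * theta_(A :|: B). *)
Definition gsign A B : K := (-1) ^+ #|inversions A B|.

Definition gone : grassmann K N := [ffun A => (A == set0)%:R].

Definition gmul F G : grassmann K N :=
  [ffun C : {set 'I_N} => \sum_(A : {set 'I_N} | A \subset C)
     gsign A (C :\: A) * (F A * G (C :\: A))].

Definition gscale (c : K) F : grassmann K N :=
  [ffun A : {set 'I_N} => c * F A].

Lemma gsign0l A : gsign set0 A = 1.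
Proof.
rewrite /gsign (_ : inversions _ _ = set0) ?cards0 //.
by apply/setP=> p; rewrite !inE.
Qed.

Lemma gsign0r A : gsign A set0 = 1.
Proof.
rewrite /gsign (_ : inversions _ _ = set0) ?cards0 //.
by apply/setP=> p; rewrite !inE andbF.
Qed.

Lemma gsignUl A B C : [disjoint A & B] ->
  gsign (A :|: B) C = gsign A C * gsign B C.
Proof.
move=> dAB; rewrite /gsign -exprD; congr (_ ^+ _).
rewrite (_ : inversions _ _ = inversions A C :|: inversions B C); last first.
  by apply/setP=> p; rewrite !inE; case: (_ \in A); case: (_ \in B);
     rewrite /= ?orbF ?orbb.
rewrite cardsU (_ : _ :&: _ = set0) ?cards0 ?subn0 //.
apply/setP=> p; rewrite !inE; case: (boolP (p.1 \in A)) => //= pA.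
by rewrite (disjointFr dAB pA) andbF.
Qed.

Lemma gsignUr A B C : [disjoint B & C] ->
  gsign A (B :|: C) = gsign A B * gsign A C.
Proof.
move=> dBC; rewrite /gsign -exprD; congr (_ ^+ _).
rewrite (_ : inversions _ _ = inversions A B :|: inversions A C); last first.
  by apply/setP=> p; rewrite !inE; case: (_ \in A); case: (_ \in B);
     case: (_ \in C); case: ltnP.
rewrite cardsU (_ : _ :&: _ = set0) ?cards0 ?subn0 //.
apply/setP=> p; rewrite !inE; case: (boolP (p.2 \in B)) => //= pB.
  by rewrite (disjointFr dBC pB) /= !andbF.
by rewrite andbF.
Qed.

Lemma gmulA : associative gmul.
Proof.
move=> F G H; apply/ffunP=> C; rewrite !ffunE.
under [RHS]eq_bigr => D _ do
  rewrite ffunE mulr_suml mulr_sumr.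
rewrite [RHS](exchange_big_dep (fun A => A \subset C)) /=; last first.
  by move=> D A sDC sAD; apply: subset_trans sAD sDC.
apply: eq_bigr => A sAC; rewrite ffunE !mulr_sumr.
rewrite [RHS](reindex_onto (fun B => A :|: B) (fun D => D :\: A)) /=; last first.
  move=> D /andP[_ sAD]; apply/setP=> x; rewrite !inE.
  by case: (boolP (x \in A)) => //= xA; rewrite (subsetP sAD).
apply: eq_big => [B|B sBCA].
  rewrite subsetD subUset sAC subsetUl andbT /=; congr (_ && _).
  apply/idP/eqP => [dBA|<-].
    apply/setP=> x; rewrite !inE; case: (boolP (x \in B)) => xB.
      by rewrite (disjointFr dBA xB) orbT.
    by case: (x \in A).
  by rewrite -setI_eq0; apply/eqP/setP=> x; rewrite !inE; case: (x \in A); rewrite ?andbF.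
have /andP[sBC dBA] : (B \subset C) && [disjoint B & A] by rewrite -subsetD.
have dAB : [disjoint A & B] by rewrite disjoint_sym.
have -> : (A :|: B) :\: A = B.
  apply/setP=> x; rewrite !inE; case: (boolP (x \in A)) => //= xA.
  by rewrite (disjointFl dBA xA).
have -> : C :\: (A :|: B) = (C :\: A) :\: B by rewrite setDDl.
set E := (C :\: A) :\: B.
have dBE : [disjoint B & E].
  by rewrite -setI_eq0; apply/eqP/setP=> x; rewrite !inE; case: (x \in B); rewrite ?andbF.
rewrite (_ : C :\: A = B :|: E); last first.
  apply/setP=> x; rewrite !inE; case: (boolP (x \in B)) => //= xB.
  by rewrite (disjointFr dBA xB) (subsetP sBC).
rewrite gsignUl // gsignUr // !mulrA; congr (_ * _ * _).
by rewrite [LHS]mulrAC; congr (_ * _); rewrite [RHS]mulrC mulrA.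
Qed.

Lemma gmul1l : left_id gone gmul.
Proof.
move=> F; apply/ffunP=> C; rewrite ffunE (bigD1 set0) ?sub0set //=.
rewrite big1 ?addr0 ?ffunE ?eqxx ?gsign0l ?setD0 ?mul1r // => A /andP[_ /negPf A0].
by rewrite ffunE A0 mul0r mulr0.
Qed.

Lemma gmul1r : right_id gone gmul.
Proof.
move=> F; apply/ffunP=> C; rewrite ffunE (bigD1 C) //=.
rewrite big1 ?addr0 ?ffunE ?setDv ?eqxx ?gsign0r ?mulr1 ?mul1r //.
move=> A /andP[sAC nAC]; rewrite ffunE setD_eq0.
case: (boolP (C \subset A)) => [sCA|_]; last by rewrite !mulr0.
by rewrite eqEsubset sAC sCA in nAC.
Qed.

Lemma gmulDl : left_distributive gmul +%R.
Proof.
move=> F G H; apply/ffunP=> C; rewrite !ffunE -big_split /=.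
by apply: eq_bigr => A _; rewrite !ffunE mulrDl mulrDr.
Qed.

Lemma gmulDr : right_distributive gmul +%R.
Proof.
move=> F G H; apply/ffunP=> C; rewrite !ffunE -big_split /=.
by apply: eq_bigr => A _; rewrite !ffunE !mulrDr.
Qed.

Lemma gone_neq0 : gone != 0.
Proof.
apply/eqP=> /ffunP/(_ set0); rewrite !ffunE eqxx => /eqP.
by rewrite oner_eq0.
Qed.

HB.instance Definition _ := GRing.Zmodule_isNzRing.Build (grassmann K N)
  gmulA gmul1l gmul1r gmulDl gmulDr gone_neq0.

Lemma gscaleA (a b : K) F : gscale a (gscale b F) = gscale (a * b) F.
Proof. by apply/ffunP=> A; rewrite !ffunE mulrA. Qed.

Lemma gscale1 : left_id 1 gscale.
Proof. by move=> F; apply/ffunP=> A; rewrite !ffunE mul1r. Qed.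

Lemma gscaleDr : right_distributive gscale +%R.
Proof. by move=> c F G; apply/ffunP=> A; rewrite !ffunE mulrDr. Qed.

Lemma gscaleDl F : {morph gscale^~ F : a b / a + b}.
Proof. by move=> a b; apply/ffunP=> A; rewrite !ffunE mulrDl. Qed.

HB.instance Definition _ := GRing.Zmodule_isLmodule.Build K (grassmann K N)
  gscaleA gscale1 gscaleDr gscaleDl.

Lemma gscaleAl (c : K) F G : c *: (F * G) = (c *: F) * G.
Proof.
apply/ffunP=> C; rewrite !ffunE mulr_sumr; apply: eq_bigr => A _.
by rewrite ffunE mulrCA !mulrA.
Qed.

HB.instance Definition _ :=
  GRing.Lmodule_isLalgebra.Build K (grassmann K N) gscaleAl.

Lemma gscaleAr (c : K) F G : c *: (F * G) = F * (c *: G).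
Proof.
apply/ffunP=> C; rewrite !ffunE mulr_sumr; apply: eq_bigr => A _.
by rewrite ffunE mulrCA; congr (_ * _); rewrite mulrCA.
Qed.

HB.instance Definition _ :=
  GRing.Lalgebra_isAlgebra.Build K (grassmann K N) gscaleAr.

Definition theta j : grassmann K N := [ffun A => (A == [set j])%:R].

(* Left derivative: it sends theta_(j |: A), for j \notin A, to
   (-1) ^ #{i in A | i < j} theta_A, and theta_A to 0 if j \notin A.  It is the
   K-linear map determined by dtheta1 and dtheta_theta below. *)
Definition dtheta j F : grassmann K N :=
  [ffun A : {set 'I_N} => if j \in A then 0
     else (-1) ^+ #|[set i in A | (i < j)%N]| * F (j |: A)].

Lemma theta_mulE j F A : (theta j * F) A =
  if j \in A then (-1) ^+ #|[set i in A | (i < j)%N]| * F (A :\ j) else 0.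
Proof.
rewrite ffunE; case: ifP => jA; last first.
  rewrite big1 // => B sBA; rewrite ffunE; case: eqP => [EB|_].
    by rewrite EB sub1set jA in sBA.
  by rewrite mul0r mulr0.
rewrite (bigD1 [set j]) ?sub1set //= big1 ?addr0; last first.
  by move=> B /andP[_ /negPf BA]; rewrite ffunE BA mul0r mulr0.
rewrite ffunE eqxx mul1r; congr (_ ^+ _ * _).
rewrite (_ : inversions _ _ = [set (j, i) | i in [set i in A | (i < j)%N]]).
  by rewrite card_imset // => i i' [].
apply/setP=> -[a b]; rewrite !inE /=; apply/and3P/imsetP.
  move=> [/eqP-> /andP[_ bA] lt]; exists b => //; by rewrite inE bA.
case=> i; rewrite inE => /andP[iA lt] [-> ->]; split=> //.
by rewrite iA andbT; apply: contraTneq lt => ->; rewrite ltnn.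
Qed.

Lemma card_ltU1 i j A : i \notin A ->
  #|[set l in i |: A | (l < j)%N]| = ((i < j) + #|[set l in A | (l < j)%N]|)%N.
Proof.
move=> iA; case: (boolP (i < j)%N) => ij.
  rewrite (_ : [set l in _ | _] = i |: [set l in A | (l < j)%N]).
    by rewrite cardsU1 inE (negPf iA).
  by apply/setP=> l; rewrite !inE; case: eqP => [->|].
rewrite add0n; apply: eq_card => l; rewrite !inE.
by case: eqP => [->|//]; rewrite (negPf ij) !andbF.
Qed.

Lemma card_ltD1 i j A : i \in A ->
  #|[set l in A | (l < j)%N]| = ((i < j) + #|[set l in A :\ i | (l < j)%N]|)%N.
Proof. by move=> iA; rewrite -{1}(setD1K iA) card_ltU1 // !inE eqxx. Qed.

Lemma sign_ltC i j : i != j -> (-1) ^+ (i < j)%N = - (-1) ^+ (j < i)%N :> K.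
Proof. by case: ltngtP => [||/val_inj->] //; rewrite ?eqxx ?opprK. Qed.

Lemma theta_sqr i : theta i * theta i = 0.
Proof.
rewrite -[theta i in X in _ * X]mulr1; apply/ffunP=> A.
by rewrite [RHS]ffunE !theta_mulE !inE eqxx; case: ifP; rewrite ?mulr0.
Qed.

Lemma theta_anticomm i j : theta i * theta j = - (theta j * theta i).
Proof.
rewrite -[theta j in LHS]mulr1 -[theta i in RHS]mulr1.
apply/ffunP=> A; rewrite [RHS]ffunE !theta_mulE !inE.
case: (eqVneq i j) => [->|nij]; first by case: ifP; rewrite ?mulr0 oppr0.
case: (boolP (i \in A)) => iA; last by case: ifP; rewrite ?andbF ?mulr0 oppr0.
case: (boolP (j \in A)) => jA; last by rewrite andbF mulr0 oppr0.
rewrite /= (card_ltD1 i jA) (card_ltD1 j iA) !exprD (sign_ltC nij).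
rewrite setDDl (setUC [set i]) -setDDl.
set a := (-1) ^+ #|_|; set b := (-1) ^+ #|_|.
by rewrite !mulNr opprK -!mulrA; congr (_ * _); rewrite mulrCA.
Qed.

Lemma dtheta1 i : dtheta i 1 = 0.
Proof.
apply/ffunP=> A; rewrite !ffunE; case: ifP => // iA.
case: eqP => [/setP/(_ i)|_]; last by rewrite mulr0.
by rewrite !inE eqxx.
Qed.

Lemma dtheta_theta i j F :
  dtheta i (theta j * F) + theta j * dtheta i F = (i == j)%:R *: F.
Proof.
apply/ffunP=> A; rewrite ffunE [in RHS]ffunE [dtheta i (_ * _) A]ffunE !theta_mulE.
rewrite [dtheta i F _]ffunE !inE.
case: (eqVneq i j) => [->|nij].
  rewrite /= mul1r; case: (boolP (j \in A)) => jA.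
    rewrite add0r setD1K // -{1}(setD1K jA) card_ltU1 ?inE ?eqxx // ltnn add0n.
    by rewrite mulrA -expr2 sqrr_sign mul1r.
  rewrite addr0 setU1K // card_ltU1 // ltnn add0n.
  by rewrite mulrA -expr2 sqrr_sign mul1r.
rewrite mul0r /=.
case: (boolP (i \in A)) => iA; first by rewrite add0r; case: ifP; rewrite ?mulr0.
case: (boolP (j \in A)) => jA; last by rewrite mulr0 addr0.
have -> : (i |: A) :\ j = i |: (A :\ j).
  apply/setP=> l; rewrite !inE; case: (eqVneq l j) => //= ->.
  by rewrite eq_sym (negPf nij).
rewrite (card_ltU1 _ iA) (card_ltD1 i jA) !exprD (sign_ltC nij).
set a := (-1) ^+ #|_|; set b := (-1) ^+ #|_|.
by rewrite !mulNr mulrN -!mulrA (mulrCA a) signrMK (mulrCA a) addNr.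
Qed.

End Grassmann.

Arguments theta {K N}.

(* Loaded only here: the set notations of classical_sets would shadow those of
   finset used above. *)
From mathcomp Require Import mpoly.
From mathcomp Require Import classical_sets reals.

Local Open Scope classical_set_scope.

(* R[x_1, ..., x_m] (x) Lambda_2n is the Grassmann algebra over R[x_1, ..., x_m]. *)
Notation superpoly R m n := (grassmann {mpoly R[m]} n.*2).

Section Superspace.
Variables (R : realType) (m n : nat).
Implicit Types (P : superpoly R m n).

(* Indices start at 0: theta_(2j-1) and theta_(2j), for 1 <= j <= n, are
   theta (oddI j) and theta (evenI j), for j : 'I_n. *)
Definition oddI (j : 'I_n) : 'I_n.*2 :=
  Ordinal (etrans (ltn_double j n) (ltn_ord j)).
Definition evenI (j : 'I_n) : 'I_n.*2 :=
  Ordinal (etrans (ltn_Sdouble j n) (ltn_ord j)).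

Definition sX (i : 'I_m) : superpoly R m n := ('X_i : {mpoly R[m]})%:A.

Definition sdX (i : 'I_m) P : superpoly R m n :=
  [ffun A => (P A)^`M(i)].

Definition super_laplace P : superpoly R m n :=
  \sum_(j < m) sdX j (sdX j P)
  - (\sum_(j < n) dtheta (oddI j) (dtheta (evenI j) P)) *+ 4.

Definition super_euler P : superpoly R m n :=
  \sum_(j < m) sX j * sdX j P + \sum_(j < n.*2) theta j * dtheta j P.

Definition super_norm2 : superpoly R m n :=
  \sum_(j < m) sX j ^+ 2 - \sum_(j < n) theta (oddI j) * theta (evenI j).

Definition mul_norm2 P : superpoly R m n := super_norm2 * P.

Definition super_homog (k : int) : set (superpoly R m n) :=
  [set P | super_euler P = P *~ k].

Definition harmonic_tilde (k : int) : set (superpoly R m n) :=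
  [set P | super_homog k P /\ (super_laplace \o mul_norm2 \o super_laplace) P = 0].

End Superspace.

Arguments super_homog : clear implicits.
Arguments harmonic_tilde : clear implicits.

Definition is_direct_sum (V : zmodType) (U W1 W2 : set V) : Prop :=
  U = [set w1 + w2 | w1 in W1 & w2 in W2] /\ W1 `&` W2 = [set 0].

(* Main.v *)
(** Write e for the super Laplacian, f for multiplication by R^2 and M = m - 2n;
    then [e, f] = 4 E + 2 M.  Put T = e f.  On P_j one has T = f e + (4 j + 2 M),
    and e intertwines f e on P_j with T on P_(j-2), so by induction on j, starting
    from P_j = 0 for j < 0, T is annihilated on P_j by the product of the X - r_i
    with r_i = (i + 1) (4 (j - i) + 2 M).  At most one r_i vanishes, whence
    ker T^3 = ker T and im T^3 = im T on P_j.  With j = k - 2, the first equality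
    gives f e f P_j :&: ker (e f e) = 0, and the second yields for each x in P_k some
    z in P_j with T (e x) = T^3 z, that is x - f e f z in ker (e f e). *)

Require Import Defs.
From HB Require Import structures.
From mathcomp Require Import all_boot all_order all_algebra.
From mathcomp Require Import mpoly ring zify.
From mathcomp Require Import classical_sets reals.

Set Implicit Arguments.
Unset Strict Implicit.
Unset Printing Implicit Defensive.

Import Order.TTheory GRing.Theory Num.Theory.

Local Open Scope ring_scope.
Local Open Scope classical_set_scope.

(** * Polynomials in an additive endomorphism, given by their roots *)

Section Factors.
Variable V : zmodType.
Implicit Types (S T g : {additive V -> V}) (x y : V).

(** The monic polynomial with root list [s], evaluated at the operator [T] and applied to [x]. *)
Definition factors (T : V -> V) (s : seq int) x : V :=
  foldr (fun a y => T y - y *~ a) x s.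

Lemma factors_morph S T g s x : (forall y, g (S y) = T (g y)) ->
  g (factors S s x) = factors T s (g x).
Proof. by move=> gS; elim: s => //= a s IHs; rewrite raddfB raddfMz gS IHs. Qed.

(** Factors of the same operator commute, so the one of index [i] can be moved innermost. *)
Lemma factors_rem T (r : nat -> int) i (l : seq nat) x : i \in l ->
  factors T (map r l) x = factors T (map r (rem i l)) (T x - x *~ r i).
Proof.
pose g y := T y - y *~ r i.
have gT l' y : g (factors T l' y) = factors T l' (g y).
  rewrite /g; elim: l' => //= a l' <-.
  by rewrite !(raddfB T) !(raddfMz T) !mulrzBl !opprD (mulrzAC a) addrACA.
elim: l => //= j l IHl; rewrite inE eq_sym; case: eqVneq => [-> _|_ /= il].
  by rewrite -gT.
by rewrite IHl.
Qed.

(** On the kernel of [T], a polynomial in [T] acts as its constant term. *)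
Lemma factors_ker T s y : T y = 0 ->
  factors T s y = y *~ \prod_(a <- s) (- a).
Proof.
move=> Ty0; elim: s => [|a s IHs] /=; first by rewrite big_nil mulr1z.
by rewrite IHs raddfMz Ty0 mul0rz sub0r big_cons mulNr mulrNz mulrzA mulrzAC.
Qed.

End Factors.

(** * Kernel and image of powers of e f on weight spaces of an sl2-action *)

Section Sl2.
Variables (V : zmodType) (e f h : {additive V -> V}) (M : int).
(** All scalars that occur are integers, so an abelian group replaces a vector space, as long as
    nonzero integers act injectively and can be divided by inside each weight space. *)
Hypothesis V_torsion_free : forall (c : int) (x : V), c != 0 -> x *~ c = 0 -> x = 0.
Hypothesis weight_divisible : forall (c j : int) (x : V), c != 0 ->
  h x = x *~ j -> exists2 y, h y = y *~ j & y *~ c = x.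
Hypothesis he : forall x, h (e x) = e (h x) - e x *+ 2.
Hypothesis hf : forall x, h (f x) = f (h x) + f x *+ 2.
Hypothesis ef_comm : forall x, e (f x) = f (e x) + h x *+ 4 + x *~ (2 * M).
Hypothesis h_ge0 : forall x (j : int), j < 0 -> h x = x *~ j -> x = 0.
Implicit Types (x y z : V) (j : int).

(* Variables rather than definitions: simplification would unfold the composites. *)
Variables (ef fe : {additive V -> V}).
Hypothesis efE : forall x, ef x = e (f x).
Hypothesis feE : forall x, fe x = f (e x).

Lemma weight_e x j : h x = x *~ j -> h (e x) = e x *~ (j - 2).
Proof. by move=> hx; rewrite he hx raddfMz mulrzBr. Qed.

Lemma weight_f x j : h x = x *~ j -> h (f x) = f x *~ (j + 2).
Proof. by move=> hx; rewrite hf hx raddfMz mulrzDr. Qed.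

Lemma weight_ef x j : h x = x *~ j -> h (ef x) = ef x *~ j.
Proof. by move=> /weight_f/weight_e; rewrite efE addrK. Qed.

Lemma weight_factors_fe x j s : h x = x *~ j ->
  h (factors fe s x) = factors fe s x *~ j.
Proof.
move=> hx; elim: s => //= a s IHs.
have hfe : h (fe (factors fe s x)) = fe (factors fe s x) *~ j.
  by have /weight_f := weight_e IHs; rewrite feE subrK.
by rewrite (raddfB h) (raddfMz h) hfe IHs mulrzBl mulrzAC.
Qed.

(** On weight j the commutation relation reads e f = f e + (4 j + 2 M), so shifting the roots trades
    [ef] for [fe]. *)
Lemma factors_ef_shift x j s : h x = x *~ j ->
  factors ef [seq (4 * j + 2 * M) + a | a <- s] x = factors fe s x.
Proof.
move=> hx; elim: s => //= a s ->.
rewrite efE ef_comm -feE (weight_factors_fe s hx).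
rewrite pmulrn -mulrzA -!addrA -!mulrNz -!mulrzDr.
by congr (_ + _ *~ _); ring.
Qed.

(** The scalar by which e f acts on f^i p, for p in ker e of weight j - 2 i. *)
Definition ef_root j (i : nat) : int := i.+1%:Z * (4 * (j - i%:Z) + 2 * M).

Lemma factors_ef_eq0 n x j : j < n.*2%:Z -> h x = x *~ j ->
  factors ef (mkseq (ef_root j) n) x = 0.
Proof.
elim: n => [|n IHn] in x j *; first by move=> j0 /(h_ge0 j0).
move=> jn hx.
(* The recurrence is [ef_root j i.+1 = (4 * j + 2 * M) + ef_root (j - 2) i]. *)
have -> : mkseq (ef_root j) n.+1 = (4 * j + 2 * M) ::
    [seq (4 * j + 2 * M) + a | a <- mkseq (ef_root (j - 2)) n].
  rewrite /mkseq /= /ef_root subr0 mul1r -[1%N]addn0 iotaDl -!map_comp.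
  by congr cons; apply: eq_map => i /=; rewrite /ef_root; lia.
rewrite /= (factors_ef_shift _ hx) efE ef_comm (weight_factors_fe _ hx).
rewrite (pmulrn (_ *~ j)) -mulrzA -!addrA -mulrzBr -mulrzDr.
rewrite [X in _ *~ X](_ : _ = 0) ?addr0; last by ring.
(* The factor of root 4 j + 2 M has become f e; since e (f e) = (e f) e, the remaining factors pass
   through e and act on [e x], of weight j - 2. *)
rewrite (factors_morph (T := ef)) => [|y]; last by rewrite feE efE.
  by rewrite IHn ?raddf0 ?(weight_e hx) //; lia.
Qed.

(** A vanishing root contributes the factor [ef] itself, which is the innermost [ef] here; no other
    root vanishes, since 4 (j - i) + 2 M = 0 determines i. If no root vanishes, the full list
    applies to [ef x], again of weight j. *)
Lemma factors_ef_nonzero j : exists2 s : seq int, 0 \notin s &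
  forall x, h x = x *~ j -> factors ef s (ef x) = 0.
Proof.
pose n := `|j|.+1.
have jn : j < n.*2%:Z by rewrite /n; lia.
case: (boolP (has (fun i => ef_root j i == 0) (iota 0 n))) => [|no0].
  case/hasP=> i ni /eqP ri0.
  exists [seq ef_root j i | i <- rem i (iota 0 n)].
    apply/negP=> /mapP[i'].
    rewrite mem_rem_uniq ?iota_uniq // !inE => /andP[/eqP i'i _] /esym/eqP.
    by move: ri0 => /eqP; rewrite !mulf_eq0 /=; lia.
  by move=> x /(factors_ef_eq0 jn); rewrite (factors_rem _ _ _ ni) ri0 subr0.
exists (mkseq (ef_root j) n).
  by apply: contra no0 => /mapP[i ni ri]; apply/hasP; exists i => //; rewrite -ri.
by move=> x hx; apply: factors_ef_eq0; rewrite ?(weight_ef hx).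
Qed.

Lemma prod_opp_neq0 (s : seq int) : 0 \notin s -> \prod_(a <- s) - a != 0.
Proof.
by move=> s0; rewrite prodf_seq_neq0; apply/allP=> a sa /=; rewrite oppr_eq0;
   apply: contraNneq s0 => <-.
Qed.

(** A polynomial in [ef] is its constant term plus a multiple of [ef], and the quotient preserves
    the weight. *)
Lemma factors_ef_mod s x j : h x = x *~ j ->
  exists2 z, h z = z *~ j & factors ef s x = x *~ \prod_(a <- s) - a + ef z.
Proof.
move=> hx; elim: s => [|a s [z hz IHs]] /=.
  by exists 0; rewrite ?raddf0 ?mul0rz // big_nil addr0.
exists (factors ef s x - z *~ a); last first.
  rewrite raddfB raddfMz addrCA; congr (_ + _); rewrite IHs mulrzDl opprD.
  by congr (_ - _); rewrite big_cons mulNr mulrNz mulrzA mulrzAC.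
rewrite (raddfB h) (raddfMz h) hz IHs (raddfD h) (raddfMz h) hx (weight_ef hz).
by rewrite mulrzBl mulrzDl !(mulrzAC _ j).
Qed.

(** The annihilating factors act on [ef x], an element of ker [ef], by their constant term, which is
    a nonzero integer. *)
Lemma ker_ef_sqr x j : h x = x *~ j -> ef (ef x) = 0 -> ef x = 0.
Proof.
move=> hx efx0; have [s s0 /(_ x hx)] := factors_ef_nonzero j.
rewrite (factors_ker _ efx0) => /V_torsion_free; apply; exact: prod_opp_neq0.
Qed.

(** The annihilating polynomial gives 0 = c (ef x) + ef (ef z) with c nonzero, so -z/c is the
    witness. *)
Lemma img_ef_sqr x j : h x = x *~ j ->
  exists2 z, h z = z *~ j & ef x = ef (ef z).
Proof.
move=> hx; have [s /prod_opp_neq0 c0 /(_ x hx)] := factors_ef_nonzero j.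
rewrite -(factors_morph (S := ef)) //.
have [z hz ->] := factors_ef_mod s hx; set c := \prod_(a <- s) _ in c0 *.
have [w hw cw] := weight_divisible c0 hz.
move=> fx0; exists (- w); first by rewrite raddfN hw mulNrz.
apply/eqP; rewrite -subr_eq0; apply/eqP/(V_torsion_free c0).
rewrite -fx0 raddfD raddfMz mulrzBl; congr (_ + _).
by rewrite -!(raddfMz ef) mulNrz cw !(raddfN ef) opprK.
Qed.

Lemma ker_ef_cube x j : h x = x *~ j -> ef (ef (ef x)) = 0 -> ef x = 0.
Proof. by move=> hx /(ker_ef_sqr (weight_ef hx))/(ker_ef_sqr hx). Qed.

Lemma img_ef_cube x j : h x = x *~ j ->
  exists2 z, h z = z *~ j & ef x = ef (ef (ef z)).
Proof.
move=> /img_ef_sqr[y /img_ef_sqr[z hz yz] ->].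
by exists z; rewrite // yz.
Qed.

End Sl2.

(** * The decomposition of a weight space *)

Section Sl2Decomposition.
Variables (V : zmodType) (e f h : {additive V -> V}) (M : int).
Hypothesis V_torsion_free :
  forall (c : int) (x : V), c != 0 -> x *~ c = 0 -> x = 0.
Hypothesis weight_divisible : forall (c j : int) (x : V), c != 0 ->
  h x = x *~ j -> exists2 y, h y = y *~ j & y *~ c = x.
Hypothesis he : forall x, h (e x) = e (h x) - e x *+ 2.
Hypothesis hf : forall x, h (f x) = f (h x) + f x *+ 2.
Hypothesis ef_comm : forall x, e (f x) = f (e x) + h x *+ 4 + x *~ (2 * M).
Hypothesis h_ge0 : forall (x : V) (j : int), j < 0 -> h x = x *~ j -> x = 0.

Lemma sl2_direct_sum (k : int) :
  is_direct_sum [set x | h x = x *~ k]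
    [set x | h x = x *~ k /\ (e \o f \o e) x = 0]
    ((f \o e \o f) @` [set x | h x = x *~ (k - 2)]).
Proof.
pose ef : {additive V -> V} := e \o f.
pose fe : {additive V -> V} := f \o e.
have efE x : ef x = e (f x) by [].
have feE x : fe x = f (e x) by [].
have weight_fef x : h x = x *~ (k - 2) -> h (f (e (f x))) = f (e (f x)) *~ k.
  by move=> /(weight_f hf)/(weight_e he)/(weight_f hf); rewrite addrK subrK.
split; apply/seteqP; split=> x /=.
- move=> hx; have := weight_e he hx.
  case/(img_ef_cube V_torsion_free weight_divisible he hf ef_comm h_ge0 efE feE).
  (* Here [xz] says that x and f e f z have the same image under e f e. *)
  move=> z hz; rewrite !efE => xz; exists (x - f (e (f z))).
    split; first by rewrite raddfB hx (weight_fef _ hz) mulrzBl.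
    by rewrite !raddfB xz subrr.
  by exists (f (e (f z))); [exists z | rewrite subrK].
- by case=> y [hy _] [_ [z hz <-] <-]; rewrite raddfD hy (weight_fef _ hz) mulrzDl.
- case=> -[_ ex0] [z hz xz]; rewrite -xz in ex0 *.
  (* For x = f e f z, the condition e f e x = 0 is (e f)^3 z = 0; then e f z = 0, and x = f (e f z)
     vanishes. *)
  have := ker_ef_cube V_torsion_free he hf ef_comm h_ge0 efE feE hz ex0.
  by rewrite efE => ->; rewrite raddf0.
- move=> ->; rewrite raddf0 mul0rz !raddf0; split=> //.
  by exists 0; rewrite !raddf0 ?mul0rz.
Qed.

End Sl2Decomposition.

(** * Odd derivatives and generators of the Grassmann algebra *)

Section GrassmannOperators.
Variables (K : comNzRingType) (N : nat).
Implicit Types (A : {set 'I_N}) (P : grassmann K N) (i j : 'I_N).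

Fact dtheta_is_zmod_morphism i : zmod_morphism (@dtheta K N i).
Proof.
by move=> P Q; apply/ffunP=> A; rewrite !ffunE; case: ifP; rewrite ?subr0 ?mulrBr.
Qed.

HB.instance Definition _ i := GRing.isZmodMorphism.Build
  (grassmann K N) (grassmann K N) (@dtheta K N i) (dtheta_is_zmod_morphism i).

Lemma dthetaZ i c P : dtheta i (c *: P) = c *: dtheta i P.
Proof.
by apply/ffunP=> A; rewrite !ffunE; case: ifP; rewrite ?mulr0 // mulrCA.
Qed.

(** The two signs both count the elements of A below j and cancel, leaving the projection onto the
    monomials that contain theta_j. *)
Lemma theta_dthetaE j P A :
  (theta j * dtheta j P) A = if j \in A then P A else 0.
Proof.
rewrite theta_mulE; case: ifP => // jA; rewrite ffunE !inE eqxx /= finset.setD1K //.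
by rewrite (card_ltD1 _ jA) ltnn add0n mulrA -expr2 sqrr_sign mul1r.
Qed.

Lemma sum_theta_dthetaE P A :
  (\sum_j theta j * dtheta j P) A = P A *+ #|A|.
Proof.
rewrite sum_ffunE (eq_bigr _ (fun j _ => theta_dthetaE j P A)) -big_mkcond /=.
by rewrite sumr_const.
Qed.

Lemma dtheta_theta_mul i j P :
  dtheta i (theta j * P) = (if i == j then P else 0) - theta j * dtheta i P.
Proof.
apply: (canRL (addrK _)); rewrite dtheta_theta.
by case: eqP; rewrite ?scale1r ?scale0r.
Qed.

Lemma dtheta_theta2 i a b P :
  dtheta i (theta a * theta b * P) = theta a * theta b * dtheta i P +
    ((if i == a then theta b * P else 0) - (if i == b then theta a * P else 0)).
Proof.
rewrite -mulrA !dtheta_theta_mul mulrBr (fun_if ( *%R (theta a))) mulr0.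
by rewrite -!mulrA opprB addrCA.
Qed.

Lemma theta2_comm i a b :
  theta i * (theta a * theta b) = theta a * theta b * theta i :> grassmann K N.
Proof.
rewrite mulrA (theta_anticomm _ i a) -[RHS]mulrA (theta_anticomm _ b i).
by rewrite mulNr mulrN mulrA.
Qed.

End GrassmannOperators.

(** * Euler operators, diagonal on coefficients *)

Lemma mderiv_euler (R : comNzRingType) m (p : {mpoly R[m]}) (mu : 'X_{1..m}) :
  (\sum_i 'X_i * p^`M(i))@_mu = p@_mu *+ mdeg mu.
Proof.
have eulerX nu : \sum_i 'X_i * ('X_[nu])^`M(i) = (mdeg nu)%:R *: 'X_[nu] :> {mpoly R[m]}.
  rewrite mdegE natr_sum scaler_suml; apply: eq_bigr => i _.
  rewrite mderivX -scalerAr -mpolyXD.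
  (* Exponents are subtracted with truncation, so multiplying by ['X_i] restores [nu] only if [nu i]
     is positive; otherwise the scalar [nu i] is 0. *)
  case: (posnP (nu i)) => [->|nui]; first by rewrite !scale0r.
  by rewrite addmC submK // lep1mP -lt0n.
rewrite {1}[p]mpolyE.
under eq_bigr => i _ do rewrite raddf_sum mulr_sumr.
rewrite exchange_big /= raddf_sum.
under eq_bigr => nu _.
  under eq_bigr => i _ do rewrite mderivZ -scalerAr.
  rewrite -scaler_sumr eulerX /= mcoeffZ mcoeffZ mcoeffX mulrCA.
  over.
transitivity ((\sum_(nu <- msupp p) p@_nu *: 'X_[nu])@_mu *+ mdeg mu); last first.
  by rewrite -mpolyE.
rewrite [X in X *+ _]raddf_sum -sumrMnl; apply: eq_bigr => nu _ /=.
rewrite mcoeffZ mcoeffX; case: eqP => [->|_]; last by rewrite !mulr0 mul0rn.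
by rewrite !mulr1 mulr_natl.
Qed.

(* Models the super Euler operator, which is diagonal on coefficients: the
   coefficient c i has weight d i. *)
Section DiagonalOperator.
Variables (F : numDomainType) (V : zmodType) (I : Type).
Variables (c : I -> {additive V -> F}) (d : I -> nat) (E : V -> V).
Hypothesis c_inj : forall x y, (forall i, c i x = c i y) -> x = y.
Hypothesis cE : forall i x, c i (E x) = c i x *+ d i.

Lemma diagonal_is_zmod_morphism : zmod_morphism E.
Proof. by move=> x y; apply: c_inj => i; rewrite raddfB !cE raddfB mulrnBl. Qed.

Lemma diagonal_scale (D : V -> V) (a : F) x :
  (forall i y, c i (D y) = a * c i y) -> E (D x) = D (E x).
Proof. by move=> cD; apply: c_inj => i; rewrite cE !cD cE mulrnAr. Qed.

(** D reads its coefficient at i from the index s i, one degree higher, hence lowers the weight by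
    one. Where t i = 0 nothing is read, so the degree of s i is free there. *)
Lemma diagonal_lower (D : V -> V) (s : I -> I) (t : I -> F) x :
    (forall i y, c i (D y) = t i * c (s i) y) ->
    (forall i, t i != 0 -> d (s i) = (d i).+1) ->
  E (D x) = D (E x) - D x.
Proof.
move=> cD ds; apply: c_inj => i; rewrite raddfB cE !cD cE.
case: (eqVneq (t i) 0) => [->|/ds->]; first by rewrite !mul0r mul0rn subr0.
by rewrite mulrSr mulrDr addrK mulrnAr.
Qed.

(** Each coefficient is killed by d i - k, which is positive. *)
Lemma diagonal_ge0 x (k : int) : k < 0 -> E x = x *~ k -> x = 0.
Proof.
case: k => // k _ Ex; apply: c_inj => i; apply/eqP.
have := cE i x; rewrite Ex raddfMz NegzE mulrNz -pmulrn => /esym/eqP.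
by rewrite -addr_eq0 -mulrnDr addnS mulrn_eq0 /= raddf0.
Qed.

End DiagonalOperator.

(** * Pairs of odd generators *)

Lemma sum_oddI_evenI (V : nmodType) n (g : 'I_n.*2 -> V) :
  \sum_j g j = \sum_(j < n) (g (oddI j) + g (evenI j)).
Proof.
have halfP (i : 'I_n.*2) : (i./2 < n)%N by have := ltn_ord i; lia.
(* Indices start at 0, so the values of [oddI] are the even ordinals. *)
rewrite (bigID (fun j : 'I_n.*2 => ~~ odd j)) big_split /=; congr (_ + _).
  rewrite (reindex_onto (@oddI n) (fun i => Ordinal (halfP i))) /=; last first.
    by move=> i evi; apply: val_inj => /=; lia.
  apply: eq_bigl => j; rewrite odd_double /=.
  by apply/eqP/val_inj; rewrite /= doubleK.
rewrite (reindex_onto (@evenI n) (fun i => Ordinal (halfP i))) /=; last first.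
  by move=> i evi; apply: val_inj => /=; lia.
apply: eq_bigl => j; rewrite odd_double /=.
by apply/eqP/val_inj; rewrite /= uphalf_double.
Qed.

Lemma oddI_eq n (a b : 'I_n) : (oddI a == oddI b) = (a == b).
Proof. by rewrite -!(inj_eq val_inj) /=; lia. Qed.

Lemma evenI_eq n (a b : 'I_n) : (evenI a == evenI b) = (a == b).
Proof. by rewrite -!(inj_eq val_inj) /=; lia. Qed.

Lemma oddI_evenI n (a b : 'I_n) : (oddI a == evenI b) = false.
Proof. by rewrite -!(inj_eq val_inj) /=; lia. Qed.

(** The contribution of one pair to [euler_theta_norm2]: a, b are its two generators, c is R^2, and
    u, v are the derivatives of p along the pair. *)
Lemma mul_swap_anticomm (A : nzRingType) (a b c u v p : A) :
  a * c = c * a -> b * c = c * b -> b * a = - (a * b) ->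
  a * (c * u - b * p) + b * (c * v + a * p) =
    c * (a * u + b * v) - a * b * p *+ 2.
Proof.
move=> ac bc ba; rewrite mulrBr !mulrDr !mulrA ac bc ba mulNr addrACA.
by rewrite -opprD -mulr2n.
Qed.

(* Locked because comparing two such sums up to conversion unfolds the arithmetic of
   the Grassmann algebra and practically diverges. *)
HB.lock Definition laplace_x (R : realType) m n (P : superpoly R m n) :
  superpoly R m n := \sum_(j < m) sdX j (sdX j P).
HB.lock Definition laplace_theta (R : realType) m n (P : superpoly R m n) :
  superpoly R m n := \sum_(j < n) dtheta (oddI j) (dtheta (evenI j) P).
HB.lock Definition euler_x (R : realType) m n (P : superpoly R m n) :
  superpoly R m n := \sum_(j < m) sX R n j * sdX j P.
HB.lock Definition euler_theta (R : realType) m n (P : superpoly R m n) :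
  superpoly R m n :=
  \sum_(j < n) (theta (oddI j) * dtheta (oddI j) P
                + theta (evenI j) * dtheta (evenI j) P).
HB.lock Definition norm2_x (R : realType) m n : superpoly R m n :=
  \sum_(j < m) sX R n j ^+ 2.
HB.lock Definition norm2_theta (R : realType) m n : superpoly R m n :=
  \sum_(j < n) theta (oddI j) * theta (evenI j).
HB.lock Definition norm2 (R : realType) m n : superpoly R m n :=
  norm2_x R m n - norm2_theta R m n.

(** * Regrouping of sums in an abelian group *)

Section ZmodRearrangement.
Variable V : zmodType.
Implicit Types a b c d p q x y : V.

Lemma subACA a b c d : a - b - (c - d) = a - c - (b - d).
Proof. by rewrite !opprD addrACA. Qed.

Lemma addrCDA a b c d : a + b + (c + d) = a + (b + d) + c.
Proof. by rewrite [c + d]addrC !addrA. Qed.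

Lemma sub_addCA a b c d : a - b + (c - d) = a - (d + b) + c.
Proof. by rewrite addrCDA [d + b]addrC opprD. Qed.

Lemma add_sub_collect a b x y p q :
  a + x + p - (b - y + q) = a - b + (x + y) + (p - q).
Proof. by rewrite !opprD opprK addrACA; congr (_ + _); rewrite addrACA. Qed.

End ZmodRearrangement.

(** * Additivity of the operators on superspace *)

Section SuperspaceOperators.
Variables (R : realType) (m n : nat).
Implicit Types (P Q : superpoly R m n).

Fact sdX_is_zmod_morphism i : zmod_morphism (@sdX R m n i).
Proof. by move=> P Q; apply/ffunP=> A; rewrite !ffunE mderivB. Qed.

HB.instance Definition _ i := GRing.isZmodMorphism.Build
  (superpoly R m n) (superpoly R m n) (@sdX R m n i) (sdX_is_zmod_morphism i).

Local Notation norm2_x := (norm2_x R m n).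
Local Notation norm2_theta := (norm2_theta R m n).
Local Notation norm2 := (norm2 R m n).

Lemma super_laplaceE P : super_laplace P = laplace_x P - laplace_theta P *+ 4.
Proof. by rewrite laplace_x.unlock laplace_theta.unlock. Qed.

Lemma super_eulerE P : super_euler P = euler_x P + euler_theta P.
Proof.
rewrite euler_x.unlock euler_theta.unlock.
by rewrite -(sum_oddI_evenI (fun j => theta j * dtheta j P)).
Qed.

Lemma mul_norm2E P : mul_norm2 P = norm2 * P.
Proof. by rewrite norm2.unlock norm2_x.unlock norm2_theta.unlock. Qed.

Fact laplace_x_is_zmod_morphism : zmod_morphism (@laplace_x R m n).
Proof.
move=> P Q; rewrite laplace_x.unlock -sumrB.
by apply: eq_bigr => j _; rewrite !raddfB.
Qed.

HB.instance Definition _ := GRing.isZmodMorphism.Build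
  (superpoly R m n) (superpoly R m n) (@laplace_x R m n) laplace_x_is_zmod_morphism.

Fact laplace_theta_is_zmod_morphism : zmod_morphism (@laplace_theta R m n).
Proof.
move=> P Q; rewrite laplace_theta.unlock -sumrB.
by apply: eq_bigr => j _; rewrite !raddfB.
Qed.

HB.instance Definition _ := GRing.isZmodMorphism.Build
  (superpoly R m n) (superpoly R m n) (@laplace_theta R m n)
  laplace_theta_is_zmod_morphism.

Fact super_laplace_is_zmod_morphism : zmod_morphism (@super_laplace R m n).
Proof.
move=> P Q; rewrite !super_laplaceE.
rewrite (raddfB (@laplace_x R m n)) (raddfB (@laplace_theta R m n)) mulrnBl.
exact: subACA.
Qed.

HB.instance Definition _ := GRing.isZmodMorphism.Build
  (superpoly R m n) (superpoly R m n) (@super_laplace R m n)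
  super_laplace_is_zmod_morphism.

Fact mul_norm2_is_zmod_morphism : zmod_morphism (@mul_norm2 R m n).
Proof. by move=> P Q; rewrite /mul_norm2 mulrBr. Qed.

HB.instance Definition _ := GRing.isZmodMorphism.Build
  (superpoly R m n) (superpoly R m n) (@mul_norm2 R m n)
  mul_norm2_is_zmod_morphism.

Lemma sX_scale i P : sX R n i * P = ('X_i : {mpoly R[m]}) *: P.
Proof. exact: mulr_algl. Qed.

Lemma sX_comm i P Q : sX R n i * (P * Q) = P * (sX R n i * Q).
Proof. by rewrite !sX_scale scalerAr. Qed.

Lemma commr_sX i P : GRing.comm P (sX R n i).
Proof. by have := sX_comm i P 1; rewrite !mulr1. Qed.

(** * Monomial coefficients and the Euler grading *)

Definition scoef (i : {set 'I_n.*2} * 'X_{1..m}) P : R := (P i.1)@_i.2.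

Fact scoef_is_zmod_morphism i : zmod_morphism (scoef i).
Proof. by move=> P Q; rewrite /scoef !ffunE mcoeffB. Qed.

HB.instance Definition _ i := GRing.isZmodMorphism.Build
  (superpoly R m n) R (scoef i) (scoef_is_zmod_morphism i).

Lemma scoef_inj P Q : (forall i, scoef i P = scoef i Q) -> P = Q.
Proof. by move=> PQ; apply/ffunP=> A; apply/mpolyP=> mu; exact: PQ (A, mu). Qed.

Lemma scoef_euler i P :
  scoef i (super_euler P) = scoef i P *+ (mdeg i.2 + #|i.1|).
Proof.
case: i => A mu; rewrite /scoef /= /super_euler ffunE mcoeffD.
rewrite sum_theta_dthetaE mcoeffMn mulrnDr; congr (_ + _).
rewrite sum_ffunE -mderiv_euler; congr (_@_mu); apply: eq_bigr => i _.
by rewrite sX_scale !ffunE.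
Qed.

HB.instance Definition _ := GRing.isZmodMorphism.Build
  (superpoly R m n) (superpoly R m n) (@super_euler R m n)
  (diagonal_is_zmod_morphism scoef_inj scoef_euler).

(** The scalars of the module are polynomials; real ones enter as the constants [c%:MP]. *)
Lemma super_eulerZ (c : R) P :
  super_euler (c%:MP *: P) = c%:MP *: super_euler P.
Proof.
apply: (diagonal_scale scoef_inj scoef_euler (D := fun P => c%:MP *: P)) => i Q.
by rewrite /= /scoef ffunE mcoeffCM.
Qed.

Lemma super_homog_neg P (k : int) : k < 0 -> super_homog R m n k P -> P = 0.
Proof. exact: (diagonal_ge0 scoef_inj scoef_euler). Qed.

(** * Derivatives lower the degree by one, the Laplacian by two *)

Lemma super_euler_sdX j P :
  super_euler (sdX j P) = sdX j (super_euler P) - sdX j P.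
Proof.
apply: (diagonal_lower scoef_inj scoef_euler (D := sdX j)
  (s := fun i => (i.1, (i.2 + U_(j))%MM))
  (t := fun i => (i.2 j).+1%:R)) => [i Q|i _ /=].
  by rewrite /= /scoef ffunE mcoeff_mderiv mulr_natl.
by rewrite mdegD mdeg1 addn1.
Qed.

Lemma super_euler_dtheta j P :
  super_euler (dtheta j P) = dtheta j (super_euler P) - dtheta j P.
Proof.
apply: (diagonal_lower scoef_inj scoef_euler (D := dtheta j)
  (s := fun i => (j |: i.1, i.2))
  (t := fun i => if j \in i.1 then 0
                 else (-1) ^+ #|[set l in i.1 | (l < j)%N]%SET|)) => [i Q|i /=].
  rewrite /= /scoef ffunE; case: ifP => _; first by rewrite mul0r mcoeff0.
  (* The signs live in different rings, polynomials on the left and reals on the right; both are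
     reduced to the same parity. *)
  rewrite -[in LHS]signr_odd -[in RHS]signr_odd !mulr_sign.
  by case: ifP; rewrite ?mcoeffN.
by case: ifPn => [_ /eqP //|jA _]; rewrite cardsU1 jA addnS.
Qed.

Lemma super_euler_laplace_x P :
  super_euler (laplace_x P) =
  laplace_x (super_euler P) - laplace_x P *+ 2.
Proof.
rewrite laplace_x.unlock raddf_sum -sumrMnl -sumrB; apply: eq_bigr => j _ /=.
by rewrite !super_euler_sdX raddfB mulr2n opprD addrA.
Qed.

Lemma super_euler_laplace_theta P : super_euler (laplace_theta P) =
  laplace_theta (super_euler P) - laplace_theta P *+ 2.
Proof.
rewrite laplace_theta.unlock raddf_sum -sumrMnl -sumrB; apply: eq_bigr => j _ /=.
by rewrite !super_euler_dtheta raddfB mulr2n opprD addrA.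
Qed.

Lemma super_euler_laplace P :
  super_euler (super_laplace P) = super_laplace (super_euler P) - super_laplace P *+ 2.
Proof.
rewrite !super_laplaceE (raddfB (@super_euler R m n)) raddfMn /=.
rewrite super_euler_laplace_x super_euler_laplace_theta.
rewrite !mulrnBl mulrnAC; exact: subACA.
Qed.

(** * Derivatives of a product with R^2 *)

Lemma sdXM i P Q : sdX i (P * Q) = sdX i P * Q + P * sdX i Q.
Proof.
apply/ffunP=> A; rewrite !ffunE raddf_sum -big_split /=; apply: eq_bigr => B _.
rewrite !ffunE -mulrDr /gsign -signr_odd !mulr_sign.
by case: ifP => _; rewrite ?mderivN mderivM.
Qed.

Lemma sdX_sX (i j : 'I_m) : sdX i (sX R n j) = (i == j)%:R.
Proof.
apply/ffunP=> A; rewrite !ffunE mderivM mderivX mnm1E.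
have -> : ((A == finset.set0)%:R : {mpoly R[m]})^`M(i) = 0.
  by case: (A == _); [exact: (mderivC _ 1) | exact: mderiv0].
rewrite mulr0 addr0; case: (eqVneq i j) => [->|ij].
  by rewrite scale1r -{1}[U_(j)%MM]add0m addmK mpolyX0 mul1r ffunE.
by rewrite scale0r mul0r ffunE.
Qed.

Lemma sdX_theta i a : sdX i (theta a : superpoly R m n) = 0.
Proof.
apply/ffunP=> A; rewrite !ffunE; case: (A == _).
  exact: (mderivC _ 1).
exact: mderiv0.
Qed.

Lemma sdX_norm2 i P :
  sdX i (norm2 * P) = norm2 * sdX i P + (sX R n i * P) *+ 2.
Proof.
have dx : sdX i norm2_x = sX R n i *+ 2.
  rewrite norm2_x.unlock raddf_sum /= (bigD1 i) //= big1 => [|j ji].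
    by rewrite expr2 sdXM sdX_sX eqxx mul1r mulr1 addr0 -mulr2n.
  by rewrite expr2 sdXM sdX_sX eq_sym (negPf ji) mul0r mulr0 addr0.
have dth : sdX i norm2_theta = 0.
  rewrite norm2_theta.unlock raddf_sum big1 // => j _ /=.
  by rewrite sdXM !sdX_theta mul0r mulr0 addr0.
have d2 : sdX i norm2 = sX R n i *+ 2 by rewrite norm2.unlock raddfB /= dx dth subr0.
by rewrite sdXM addrC d2 mulrnAl.
Qed.

Lemma dtheta_norm2_x i P : dtheta i (norm2_x * P) = norm2_x * dtheta i P.
Proof.
rewrite norm2_x.unlock !mulr_suml raddf_sum; apply: eq_bigr => j _ /=.
by rewrite expr2 -!mulrA !sX_scale !dthetaZ.
Qed.

Lemma dtheta_norm2_theta i P : dtheta i (norm2_theta * P) =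
  norm2_theta * dtheta i P
  + \sum_(j < n) ((if i == oddI j then theta (evenI j) * P else 0)
                  - (if i == evenI j then theta (oddI j) * P else 0)).
Proof.
rewrite norm2_theta.unlock !mulr_suml raddf_sum -big_split; apply: eq_bigr => j _ /=.
exact: dtheta_theta2.
Qed.

(** Only the pair of index [a] contributes. The minus sign is that of the odd part of R^2; for the
    even index below, passing the first generator of the pair reverses it. *)
Lemma dtheta_oddI_norm2 (a : 'I_n) P : dtheta (oddI a) (norm2 * P) =
  norm2 * dtheta (oddI a) P - theta (evenI a) * P.
Proof.
rewrite norm2.unlock !mulrBl (raddfB (dtheta (oddI a))) /=.
rewrite dtheta_norm2_x dtheta_norm2_theta.
rewrite opprD addrA (bigD1 a) //= big1 => [|b ba].
  by rewrite oddI_evenI eqxx subr0 addr0.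
by rewrite oddI_evenI oddI_eq [a == b]eq_sym (negPf ba) subr0.
Qed.

Lemma dtheta_evenI_norm2 (a : 'I_n) P : dtheta (evenI a) (norm2 * P) =
  norm2 * dtheta (evenI a) P + theta (oddI a) * P.
Proof.
rewrite norm2.unlock !mulrBl (raddfB (dtheta (evenI a))) /=.
rewrite dtheta_norm2_x dtheta_norm2_theta.
rewrite opprD addrA (bigD1 a) //= big1 => [|b ba].
  by rewrite [_ == oddI _]eq_sym oddI_evenI eqxx sub0r addr0 opprK.
rewrite [_ == oddI _]eq_sym oddI_evenI evenI_eq [a == b]eq_sym (negPf ba).
by rewrite subr0.
Qed.

(** R^2 is even, so its quadratic terms pass [theta i] with two cancelling sign changes. *)
Lemma theta_norm2 i : theta i * norm2 = norm2 * theta i.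
Proof.
rewrite norm2.unlock mulrBr mulrBl; congr (_ - _).
  rewrite norm2_x.unlock mulr_sumr mulr_suml; apply: eq_bigr => j _.
  exact/commrX/commr_sX.
rewrite norm2_theta.unlock mulr_sumr mulr_suml; apply: eq_bigr => j _.
exact: theta2_comm.
Qed.

(** * Commutators of the Euler and Laplace operators with R^2 *)

Lemma euler_x_norm2 P :
  euler_x (norm2 * P) = norm2 * euler_x P + norm2_x * P *+ 2.
Proof.
rewrite euler_x.unlock norm2_x.unlock mulr_sumr mulr_suml -sumrMnl -big_split.
apply: eq_bigr => j _ /=.
by rewrite sdX_norm2 mulrDr mulrnAr sX_comm expr2 -(mulrA _ _ P).
Qed.

Lemma euler_theta_norm2 P :
  euler_theta (norm2 * P) = norm2 * euler_theta P - norm2_theta * P *+ 2.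
Proof.
rewrite euler_theta.unlock norm2_theta.unlock mulr_sumr mulr_suml -sumrMnl -sumrB.
apply: eq_bigr => j _ /=.
rewrite dtheta_oddI_norm2 dtheta_evenI_norm2.
apply: mul_swap_anticomm; [exact: theta_norm2|exact: theta_norm2|].
exact: theta_anticomm.
Qed.

Lemma super_euler_norm2 P : super_euler (mul_norm2 P) =
  mul_norm2 (super_euler P) + mul_norm2 P *+ 2.
Proof.
rewrite !mul_norm2E !super_eulerE euler_x_norm2 euler_theta_norm2.
by rewrite mulrDr addrACA -mulrnBl -mulrBl norm2.unlock.
Qed.

Lemma laplace_x_norm2 P : laplace_x (norm2 * P) =
  norm2 * laplace_x P + euler_x P *+ 4 + P *+ (2 * m).
Proof.
have -> : P *+ (2 * m) = \sum_(j < m) P *+ 2.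
  by rewrite sumr_const card_ord mulrnA.
rewrite laplace_x.unlock euler_x.unlock mulr_sumr -sumrMnl -!big_split.
apply: eq_bigr => j _ /=.
rewrite sdX_norm2 raddfD raddfMn /= sdX_norm2 sdXM sdX_sX eqxx mul1r.
by rewrite mulrnDl addrCDA -mulrnDr.
Qed.

(** For each pair, the even derivative creates the first generator times P; differentiating that by
    the odd index gives one copy of P and one Euler term, and R^2 gives the other Euler term. *)
Lemma laplace_theta_norm2 P : laplace_theta (norm2 * P) =
  norm2 * laplace_theta P - euler_theta P + P *+ n.
Proof.
have -> : P *+ n = \sum_(j < n) P by rewrite sumr_const card_ord.
rewrite laplace_theta.unlock euler_theta.unlock mulr_sumr -sumrB -big_split.
apply: eq_bigr => j _ /=.
rewrite dtheta_evenI_norm2 raddfD /= dtheta_oddI_norm2 dtheta_theta_mul eqxx.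
exact: sub_addCA.
Qed.

(** The factor -4 in the Laplacian turns -E_theta + n into 4 E_theta - 4 n. With 4 E_x + 2 m this is
    4 E + 2 M, where M = m - 2 n is the superdimension. *)
Lemma super_laplace_norm2 P : super_laplace (mul_norm2 P) =
  mul_norm2 (super_laplace P) + super_euler P *+ 4 + P *~ (2 * (m%:Z - n.*2%:Z)).
Proof.
rewrite !mul_norm2E !super_laplaceE super_eulerE laplace_x_norm2 laplace_theta_norm2.
have -> : P *~ (2 * (m%:Z - n.*2%:Z)) = P *+ (2 * m) - P *+ n *+ 4.
  by rewrite -mulrnA !pmulrn -mulrzBr; congr (_ *~ _); lia.
rewrite mulrBr !mulrnDl mulNrn mulrnAr.
exact: add_sub_collect.
Qed.

(** * Division by nonzero integers *)

Lemma superpoly_divz (c : int) P : c != 0 ->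
  ((c%:~R^-1 : R)%:MP *: P) *~ c = P.
Proof.
move=> c0; rewrite -scaler_int scalerA -[c%:~R](rmorph_int (mpolyC m (R := R))).
by rewrite -mpolyCM divff ?intr_eq0 // scale1r.
Qed.

Lemma superpoly_torsion_free (c : int) P : c != 0 -> P *~ c = 0 -> P = 0.
Proof.
by move=> c0 Pc; rewrite -(superpoly_divz P c0) scalerMzr Pc scaler0.
Qed.

Lemma super_homog_divisible (c j : int) P : c != 0 -> super_euler P = P *~ j ->
  exists2 Q, super_euler Q = Q *~ j & Q *~ c = P.
Proof.
move=> c0 EP; exists ((c%:~R^-1 : R)%:MP *: P); last exact: superpoly_divz.
by rewrite super_eulerZ EP -scalerMzr.
Qed.

End SuperspaceOperators.

Theorem theorem1 (R : realType) (m n : nat) (hm : (1 <= m)%N) (k : nat) :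
  is_direct_sum (super_homog R m n k%:Z) (harmonic_tilde R m n k%:Z)
    ((@mul_norm2 R m n \o @super_laplace R m n \o @mul_norm2 R m n)
       @` super_homog R m n (k%:Z - 2%:Z)).
Proof.
(* [super_homog] and [harmonic_tilde] unfold to the weight space and the kernel of e f e in it. *)
exact: (@sl2_direct_sum (superpoly R m n) (@super_laplace R m n)
  (@mul_norm2 R m n) (@super_euler R m n) (m%:Z - n.*2%:Z)
  (@superpoly_torsion_free R m n) (@super_homog_divisible R m n)
  (@super_euler_laplace R m n) (@super_euler_norm2 R m n)
  (@super_laplace_norm2 R m n) (@super_homog_neg R m n) k%:Z).
Qed.
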